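(* Let $F$ be a field and $n\geq 2$. Let $R=M_n(F)$ and $U=\pm SL_n(F)$, where $SL_n(F)=\{A\in M_n(F)\mid\det(A)=1\}$. Then $R$ has the $2$-sum property with respect to $U$.
   Context: $\pm SL_n(F)=\{\pm A\mid A\in SL_n(F)\}$. For a subset $S$ of a ring $R$, $R$ has the $k$-sum property with respect to $S$ if every element of $R$ can be written as a sum of exactly $k$ elements of $S$. *)

(* Defs.v *)
From mathcomp Require Import all_boot all_order all_algebra.

Set Implicit Arguments.
Unset Strict Implicit.
Unset Printing Implicit Defensive.

Import GRing.Theory.
Local Open Scope ring_scope.

(* Subsets are Prop-valued predicates; the k summands need not be distinct. *)
Definition k_sum_property (R : pzRingType) (k : nat) (S : R -> Prop) : Prop :=
  forall x : R, exists s : 'I_k -> R,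
    (forall i : 'I_k, S (s i)) /\ x = \sum_(i < k) s i.

Definition SL (F : fieldType) (n : nat) (A : 'M[F]_n) : Prop := \det A = 1.

Definition pmSL (F : fieldType) (n : nat) (B : 'M[F]_n) : Prop :=
  exists A : 'M[F]_n, SL A /\ (B = A \/ B = - A).

(* Main.v *)
Require Import Defs.
From mathcomp Require Import all_boot all_order all_algebra all_fingroup.

(** Every square matrix of size at least 2 is even a difference of two
    matrices of determinant 1; the sign allowed in [pmSL] turns the difference
    into a sum.

    A matrix [M] with zero diagonal is easy to split: write [M = U + L] with [U]
    strictly upper and [L] strictly lower triangular, and choose any diagonal
    matrix [E].  Then [M = (E + U) - (E - L)], where both terms are triangular
    with diagonal [E], so both have determinant [\det E], which can be any
    prescribed scalar ([zero_diag_sub]).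

    A general [A] is [P *m M *m Q] with [P], [Q] invertible and [M] of zero
    diagonal ([equiv_zero_diag]): reduce [A] to its rank normal form, which is
    diagonal, then permute the columns without fixed point, which is where size
    at least 2 is needed.  Splitting [M] with the prescribed determinant
    [(\det P * \det Q)^-1] and multiplying back by [P] and [Q] splits [A] into
    two matrices of determinant 1 ([sub_det1]). *)

Set Implicit Arguments.
Unset Strict Implicit.
Unset Printing Implicit Defensive.

Import GRing.Theory.
Local Open Scope ring_scope.

(** Only the diagonals of the two triangular terms enter their determinants, so
    a single diagonal matrix, cancelling in the difference, controls both. *)
Lemma zero_diag_sub (R : comNzRingType) n (M : 'M[R]_n.+1) (c : R) :
    (forall i, M i i = 0) ->
  exists X Y : 'M[R]_n.+1, [/\ M = X - Y, \det X = c & \det Y = c].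
Proof.
move=> M0; pose e (i : 'I_n.+1) : R := if i == ord0 then c else 1.
have prod_e : \prod_i e i = c by rewrite big_ord_recl big1 // mulr1.
exists (\matrix_(i, j) if i == j then e i else if (i < j)%N then M i j else 0).
exists (\matrix_(i, j) if i == j then e i else if (j < i)%N then - M i j else 0).
split.
- apply/matrixP=> i j; rewrite !mxE -val_eqE.
  case: ltngtP => [_|_|/val_inj ->]; first by rewrite subr0.
    by rewrite sub0r opprK.
  by rewrite M0 subrr.
- rewrite -det_tr det_trig.
    by rewrite -[RHS]prod_e; apply: eq_bigr => i _; rewrite !mxE eqxx.
  by apply/is_trig_mxP=> i j ltij; rewrite !mxE -val_eqE; case: ltngtP ltij.
- rewrite det_trig.
    by rewrite -[RHS]prod_e; apply: eq_bigr => i _; rewrite !mxE eqxx.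
  by apply/is_trig_mxP=> i j ltij; rewrite !mxE -val_eqE; case: ltngtP ltij.
Qed.

(** The cyclic shift [i |-> i + 1] has no fixed point, so it moves every entry
    of a diagonal matrix off the diagonal. *)
Lemma equiv_zero_diag (F : fieldType) n (A : 'M[F]_n.+2) :
  exists P M Q : 'M[F]_n.+2,
    [/\ P \in unitmx, Q \in unitmx, A = P *m M *m Q & forall i, M i i = 0].
Proof.
pose s : 'S_n.+2 := perm (@addIr _ (1 : 'I_n.+2)).
exists (col_ebase A), (pid_mx (\rank A) *m perm_mx s).
exists (perm_mx s^-1 *m row_ebase A); split.
- exact: col_ebase_unit.
- by rewrite unitmx_mul unitmx_perm row_ebase_unit.
- by rewrite perm_mxV !mulmxA mulmxK ?unitmx_perm // mulmx_ebase.
- move=> i; rewrite mxE big1 // => k _; rewrite !mxE permE.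
  rewrite val_eqE; have [-> | _] := eqVneq i k; last by rewrite mul0r.
  by rewrite -subr_eq0 addrAC subrr add0r oner_eq0 mulr0.
Qed.

Lemma sub_det1 (F : fieldType) n (A : 'M[F]_n.+2) :
  exists X Y : 'M[F]_n.+2, [/\ A = X - Y, \det X = 1 & \det Y = 1].
Proof.
have [P [M [Q [uP uQ -> M0]]]] := equiv_zero_diag A.
have [X [Y [-> dX dY]]] := zero_diag_sub (\det P * \det Q)^-1 M0.
have uPQ : \det P * \det Q \is a GRing.unit by rewrite unitrM -!unitmxE uP.
exists (P *m X *m Q), (P *m Y *m Q); split; first by rewrite mulmxBr mulmxBl.
  by rewrite !det_mulmx dX mulrAC divrr.
by rewrite !det_mulmx dY mulrAC divrr.
Qed.

Theorem proposition3p3 (F : fieldType) (n : nat) (hn : (2 <= n)%N) :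
  @k_sum_property 'M[F]_n 2 (@pmSL F n).
Proof.
case: n hn => [|[|n]] // _ A.
have [X [Y [defA dX dY]]] := sub_det1 A.
exists (fun i => if i == ord0 then X else - Y); split.
  move=> i; case: (i == ord0); first by exists X; split; [|left].
  by exists Y; split; [|right].
by rewrite big_ord_recl big_ord1.
Qed.
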